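(* Let $p, d \in \mathbb{N}$ and let $D, D' \in M_p(\mathbb{C})$ be self-adjoint. Then $$\mu_D = \mu_{D'} \iff \mu^\Box_{\mathrm{CW}}(D) = \mu^\Box_{\mathrm{CW}}(D').$$
   Context: A C$^*$-probability space is a pair $(\mathfrak{A},\tau)$ of a unital C$^*$-algebra $\mathfrak{A}$ and a faithful tracial state $\tau$ on $\mathfrak{A}$. The distribution of a self-adjoint $a\in\mathfrak{A}$ is the compactly supported probability measure $\mu_a$ on $\mathbb{R}$ with $\int x^k\,\mu_a(dx)=\tau(a^k)$ for all $k\in\mathbb{N}$. Freeness is in the sense of Voiculescu: a family of $*$-subalgebras $(\mathfrak{A}_j)_{j\in J}$ is free if $\tau(a_1\cdots a_n)=0$ whenever $a_l\in\mathfrak{A}_{j_l}$, $\tau(a_l)=0$, $j_1\neq j_2\neq\cdots\neq j_n$; a family of self-adjoint elements is free if the $*$-subalgebras of polynomials in them are free. A standard semicircular element is a self-adjoint element with distribution $\frac{\sqrt{4-x^2}}{2\pi}\mathbf{1}_{[-2,2]}(x)\,dx$. A circular element of variance $v>0$ is $c=\sqrt{v}\,(s_1+is_2)/\sqrt{2}$ with $s_1,s_2$ free standard semicircular elements. A $*$-free circular family is a family $(c_j)_{j}$ of circular elements such that the family of all $\mathrm{Re}\,c_j,\mathrm{Im}\,c_j$ is free. Let $(\mathfrak{A},\tau)$ be a C$^*$-probability space containing a $*$-free family $(C_{ij})_{1\le i\le p,1\le j\le d}$ of circular elements with $\tau(C_{ij})=0$ and $\tau(C_{ij}^*C_{ij})=1/d$,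 and let $C=(C_{ij})\in M_{p,d}(\mathfrak{A})$. For self-adjoint $D\in M_p(\mathbb{C})$ put $W^\Box_{\mathrm{CW}}(D)=C^*DC\in M_d(\mathfrak{A})$, and let $\mu^\Box_{\mathrm{CW}}(D)$ be the distribution of $W^\Box_{\mathrm{CW}}(D)$ in the C$^*$-probability space $(M_d(\mathfrak{A}),\mathrm{tr}_d\otimes\tau)$, where $(\mathrm{tr}_d\otimes\tau)(X)=\frac1d\sum_{i=1}^d\tau(X_{ii})$. For a self-adjoint matrix $D\in M_p(\mathbb{C})$ with eigenvalues $\lambda_1\le\dots\le\lambda_p$ (with multiplicity), $\mu_D=\frac1p\sum_{k=1}^p\delta_{\lambda_k}$. *)

(* Defs.v *)
From HB Require Import structures.
From mathcomp Require Import all_boot all_order all_algebra.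
From mathcomp Require Import complex.
From mathcomp Require Import all_classical all_reals all_analysis measurable_realfun.

Set Implicit Arguments.
Unset Strict Implicit.
Unset Printing Implicit Defensive.

Import Order.TTheory GRing.Theory Num.Theory.
Import numFieldNormedType.Exports.

Local Open Scope classical_set_scope.
Local Open Scope ring_scope.
Local Open Scope complex_scope.

(* Unital C*-algebras over R[i].  The norm is a field of this structure because
   algebras and [completeNormedModType] have no common extension in the library
   hierarchy.  MathComp algebras satisfy 1 != 0; this excludes only the zero
   algebra, which has no state. *)
HB.mixin Record isCStarAlgebra (R : realType) A of GRing.Algebra R[i] A := {
  star : A -> A ;
  cnorm : A -> R ;
  starK : forall a, star (star a) = a ;
  starD : forall a b, star (a + b) = star a + star b ;
  starZ : forall (z : R[i]) a, star (z *: a) = Num.conj z *: star a ;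
  starM : forall a b, star (a * b) = star b * star a ;
  cnorm0_eq0 : forall a, cnorm a = 0 -> a = 0 ;
  cnormD : forall a b, cnorm (a + b) <= cnorm a + cnorm b ;
  cnormZ : forall (z : R[i]) a, cnorm (z *: a) = complex.Re `|z| * cnorm a ;
  cnormM : forall a b, cnorm (a * b) <= cnorm a * cnorm b ;
  cstar_identity : forall a, cnorm (star a * a) = cnorm a ^+ 2 ;
  cnorm_complete : forall u : nat -> A,
    (forall e : R, 0 < e -> exists N : nat, forall m n : nat,
      (N <= m)%N -> (N <= n)%N -> cnorm (u m - u n) < e) ->
    exists l : A, forall e : R, 0 < e -> exists N : nat, forall n : nat,
      (N <= n)%N -> cnorm (u n - l) < e
}.

#[short(type="cstarAlgType")]
HB.structure Definition CStarAlgebra (R : realType) :=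
  { A of GRing.Algebra R[i] A & isCStarAlgebra R A }.

Definition faithful_tracial_state (R : realType) (A : cstarAlgType R)
    (tau : {scalar A}) : Prop :=
  [/\ tau 1 = 1,
      forall a : A, 0 <= tau (star a * a),
      forall a : A, tau (star a * a) = 0 -> a = 0
    & forall a b : A, tau (a * b) = tau (b * a)].

Section Distribution.
Variable R : realType.

(* The values of a library measure outside of the sigma-algebra carry no
   information, hence equality of measures is equality on Borel sets. *)
Definition same_measure (mu nu : set (measurableTypeR R) -> \bar R) : Prop :=
  forall E : set (measurableTypeR R), measurable E -> mu E = nu E.

(* mu is the distribution of b with respect to phi.  Only the powers of b and
   phi matter, so that no norm on the ambient algebra B is needed; B will be a
   C*-algebra A or the algebra of matrices over A. *)
Definition is_distribution (B : pzRingType) (phi : B -> R[i]) (b : B)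
    (mu : {measure set (measurableTypeR R) -> \bar R}) : Prop :=
  [/\ mu [set: R] = 1%E,
      exists2 K : set R, compact K & mu (~` K) = 0%E
    & forall k : nat, (\int[mu]_x (x ^+ k))%:C = phi (b ^+ k)].

Definition semicircle_pdf (x : R) : R :=
  \1_(`[-2, 2] : set R) x * (Num.sqrt (4 - x ^+ 2) / (2 * pi)).

Definition semicircle_measure (E : set (measurableTypeR R)) : \bar R :=
  (\int[lebesgue_measure]_(x in E) (semicircle_pdf x)%:E)%E.

Lemma semicircle_pdf_ge0 x : 0 <= semicircle_pdf x.
Proof.
by rewrite /semicircle_pdf mulr_ge0 ?divr_ge0 ?sqrtr_ge0 ?mulr_ge0 ?pi_ge0.
Qed.

Lemma measurable_semicircle_pdf : measurable_fun [set: R] semicircle_pdf.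
Proof.
apply: measurable_funM; first by apply: measurable_indic; exact: measurable_itv.
apply: measurable_funM; last exact: measurable_cst.
have mS := @continuous_measurable_fun R _ (@sqrt_continuous R).
apply: (measurableT_comp mS); apply: measurable_funB.
  exact: measurable_cst.
exact: exprn_measurable.
Qed.

Let semicircle0 : semicircle_measure set0 = 0%E.
Proof. by rewrite /semicircle_measure integral_set0. Qed.

Let semicircle_ge0 E : (0 <= semicircle_measure E)%E.
Proof. by apply: integral_ge0 => x _; rewrite lee_fin semicircle_pdf_ge0. Qed.

Let semicircle_sigma_additive : semi_sigma_additive semicircle_measure.
Proof.
move=> F mF tF mUF; rewrite /semicircle_measure ge0_integral_bigcup//.
- apply: is_cvg_ereal_nneg_natsum_cond => n _ _.
  exact: semicircle_ge0.
- apply: measurable_funTS; apply/measurable_EFinP.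
  exact: measurable_semicircle_pdf.
- by move=> x _; rewrite lee_fin semicircle_pdf_ge0.
Qed.

HB.instance Definition _ := isMeasure.Build _ _ _ semicircle_measure
  semicircle0 semicircle_ge0 semicircle_sigma_additive.

End Distribution.

Section Freeness.
Variables (R : realType) (A : cstarAlgType R) (tau : {scalar A}).

(* A word a_1 ... a_n with a_l in the algebra of index j_l is encoded as the
   list of the pairs (j_l, a_l); the product over the list is taken from left
   to right. *)
Definition free_family (J : eqType) (S : J -> set A) : Prop :=
  forall w : seq (J * A), w != [::] ->
    (forall x, x \in w -> S x.1 x.2) ->
    (forall x, x \in w -> tau x.2 = 0) ->
    sorted (fun x y => x.1 != y.1) w ->
    tau (\prod_(x <- w) x.2) = 0.

Definition polynomials_in (a : A) : set A :=
  [set horner_alg a P | P in [set: {poly R[i]}]].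

Definition free_elements (J : eqType) (a : J -> A) : Prop :=
  (forall j, star (a j) = a j) /\ free_family (fun j => polynomials_in (a j)).

Definition standard_semicircular (s : A) : Prop :=
  star s = s /\ is_distribution tau s (@semicircle_measure R).

Definition circular_of_variance (v : R) (c : A) : Prop :=
  exists s1 s2 : A,
    [/\ standard_semicircular s1, standard_semicircular s2,
        free_elements (fun b : bool => if b then s1 else s2)
      & c = (Num.sqrt v / Num.sqrt 2)%:C *: (s1 + 'i *: s2)].

Definition circular (c : A) : Prop :=
  exists2 v : R, 0 < v & circular_of_variance v c.

Definition re_part (c : A) : A := 2^-1 *: (c + star c).
Definition im_part (c : A) : A := (2 * 'i)^-1 *: (c - star c).

Definition star_free_circular (J : eqType) (c : J -> A) : Prop :=
  (forall j, circular (c j)) /\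
  free_elements (fun jb : J * bool =>
    if jb.2 then re_part (c jb.1) else im_part (c jb.1)).

Definition star_mx (m n : nat) (X : 'M[A]_(m, n)) : 'M[A]_(n, m) :=
  map_mx star X^T.

(* tr_d (x) tau *)
Definition tr_state (d : nat) (X : 'M[A]_d) : R[i] :=
  d%:R^-1 * \sum_(i < d) tau (X i i).

(* W_CW(D) = C^* D C, with D in M_p(C) embedded entrywise in M_p(A) *)
Definition wishart (p d : nat) (C : 'M[A]_(p, d)) (D : 'M[R[i]]_p) : 'M[A]_d :=
  star_mx C *m map_mx (in_alg A) D *m C.

End Freeness.

(* The spectral theorem [orthomx_spectralP] writes a self-adjoint D as a unitary
   conjugate of the diagonal matrix [spectral_diag D], whose entries are thus
   the eigenvalues of D with multiplicity; they are real, see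
   [hermitian_spectral_diag_real]. *)
Definition real_eigenvalue (R : realType) (p : nat) (D : 'M[R[i]]_p)
    (k : 'I_p) : R :=
  complex.Re (spectral_diag D 0 k).

Definition spectral_measure (R : realType) (p : nat) (D : 'M[R[i]]_p)
    (E : set (measurableTypeR R)) : \bar R :=
  ((p%:R^-1 : R)%:E * \sum_(k < p) \d_(real_eigenvalue D k) E)%E.

Lemma char_poly_real_eigenvalue (R : realType) (p : nat) (D : 'M[R[i]]_p) :
  D \is hermsymmx ->
  char_poly D =
  \prod_(k < p) ('X - (real_eigenvalue D k)%:C%:P).
Proof.
move=> hD; set P := spectralmx D; set s := spectral_diag D.
have Pu : P \in unitmx by exact: spectral_unit.
have /orthomx_spectralP DE := hermitian_normalmx hD.
have -> : char_poly D = char_poly (diag_mx s).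
  rewrite /char_poly -/P -/s in DE *.
  have -> : char_poly_mx D = map_mx polyC (invmx P) *m char_poly_mx (diag_mx s)
                              *m map_mx polyC P.
    rewrite {1}DE /char_poly_mx !map_mxM mulmxBr mulmxBl.
    congr (_ - _).
    by rewrite scalar_mxC -mulmxA -map_mxM mulVmx// map_mx1 mulmx1.
  rewrite !det_mulmx mulrAC -det_mulmx -map_mxM mulVmx//.
  by rewrite map_mx1 det1 mul1r.
rewrite char_poly_trig ?diag_mx_is_trig//; apply: eq_bigr => k _.
rewrite !mxE eqxx mulr1n; congr ('X - _%:P).
have /mxOverP/(_ 0 k) := hermitian_spectral_diag_real hD.
by rewrite -/s => /RRe_real.
Qed.

(* Main.v *)
Require Import Defs.
From HB Require Import structures.
From mathcomp Require Import all_boot all_order all_algebra.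
From mathcomp Require Import complex ring lra zify.
From mathcomp Require Import all_classical all_reals all_analysis measurable_realfun.

Set Implicit Arguments.
Unset Strict Implicit.
Unset Printing Implicit Defensive.

Import Order.TTheory GRing.Theory Num.Theory.
Import numFieldNormedType.Exports.

Local Open Scope classical_set_scope.
Local Open Scope ring_scope.
Local Open Scope complex_scope.

(** With [V = D C C^*], [N_k = (id (x) tau)(V^k)] and
    [m_n = (tr_d (x) tau)((C^* D C)^n)], the Schwinger-Dyson equation for the free
    circular family reads
      [m_{n+1} = d^-1 \sum_(k <= n) tr (N_k D) m_{n-k}],
      [N_0 = 1],  [N_{k+1} = \sum_(l <= k) m_l D N_{k-l}].
    Hence [m_n] is a polynomial in [tr D, ..., tr D^n], the same for all [D], and
    it is triangular: [tr D^n] enters with coefficient [d^-1].  The moments of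
    [C^* D C] and the power sums of the eigenvalues of [D] therefore determine
    each other.  Compactly supported laws are determined by their moments,
    finite multisets of reals by their power sums. *)

(** * Difference quotients and words in free elements *)

(** Freeness speaks only of alternating products of centred polynomials in single elements, while
    moments of [wishart C D] involve arbitrary products. The letters of a word are therefore whole
    polynomials, so that merging neighbours and subtracting constants stay inside the class of
    words. On alternating centred words both sides of the Schwinger-Dyson equation vanish unless the
    word has exactly one letter; there it is the one-variable semicircular equation, which comes
    from the density by integration by parts.

    Free elements are self-adjoint, whereas entries of [C] are not: they are complex combinations of
    their free real and imaginary parts. Under the bilinear covariance (without conjugation) an
    entry pairs with its own adjoint and with nothing else, which is why differentiation cuts a
    matrix product only at factors of one kind and the two recursions close. They mix matrices with
    scalars; taking the traces of [D^j N_k D] for all [j] gives a purely scalar system. *)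

Lemma scalar_sum (K : comNzRingType) (V : lmodType K) (I : Type) (r : seq I)
    (P : pred I) (a : I -> K) (x : I -> V) (f : V -> K) : scalar f ->
  f (\sum_(i <- r | P i) a i *: x i) = \sum_(i <- r | P i) a i * f (x i).
Proof.
move=> fl.
have f0 : f 0 = 0 by have := fl (-1) 0 0; rewrite scaler0 addr0 mulN1r addNr.
by elim/big_rec2: _ => // i y1 y2 _ <-; rewrite fl.
Qed.

(** Difference quotients, integrals of polynomials and sums over eigenvalues are all compared
    through this reduction to monomials. *)
Lemma poly_scalar_ext (K : comNzRingType) (f g : {poly K} -> K) :
  scalar f -> scalar g -> (forall n, f 'X^n = g 'X^n) -> f =1 g.
Proof.
move=> fl gl fg P; rewrite -[P]coefK poly_def !scalar_sum//.
by apply: eq_bigr => i _; rewrite fg.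
Qed.

Section DifferenceQuotient.
Variables (R : realType) (A : cstarAlgType R) (tau : {scalar A}) (s : A).

(* [(tau (x) tau) ((u (x) 1) dP (1 (x) w))], where
   [dX^n = \sum_(a < n) X^a (x) X^(n-1-a)] is evaluated at [s]. *)
Definition diffquo (u w : A) (P : {poly R[i]}) : R[i] :=
  \sum_(n < size P) P`_n *
    \sum_(a < n) tau (u * s ^+ a) * tau (s ^+ (n - a.+1) * w).

Lemma diffquo_widen N u w (P : {poly R[i]}) : (size P <= N)%N ->
  diffquo u w P = \sum_(n < N) P`_n *
    \sum_(a < n) tau (u * s ^+ a) * tau (s ^+ (n - a.+1) * w).
Proof.
move=> PN; pose F n := P`_n * \sum_(a < n) tau (u * s ^+ a) * tau (s ^+ (n - a.+1) * w).
rewrite /diffquo (big_ord_widen N F)// big_mkcond/=; apply: eq_bigr => i _; case: ifPn => //.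
by rewrite -leqNgt => /(nth_default 0) ->; rewrite mul0r.
Qed.

Lemma diffquo_linear u w : scalar (diffquo u w).
Proof.
move=> a P Q; set N := maxn (size P) (size Q).
have sPQ : (size (a *: P + Q)%R <= N)%N.
  rewrite (leq_trans (size_polyD _ _))// geq_max leq_maxr andbT.
  by rewrite (leq_trans (size_scale_leq _ _))// leq_maxl.
rewrite (diffquo_widen _ _ sPQ) (diffquo_widen _ _ (leq_maxl _ _ : (_ <= N)%N)).
rewrite (diffquo_widen _ _ (leq_maxr _ _ : (_ <= N)%N)) mulr_sumr -big_split/=.
by apply: eq_bigr => i _; rewrite coefD coefZ mulrDl mulrA.
Qed.

HB.instance Definition _ u w :=
  GRing.isLinear.Build R[i] {poly R[i]} R[i] *%R (diffquo u w)
    (diffquo_linear u w).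

Lemma diffquoXn u w n : diffquo u w 'X^n =
  \sum_(a < n) tau (u * s ^+ a) * tau (s ^+ (n - a.+1) * w).
Proof.
rewrite /diffquo size_polyXn big_ord_recr/= coefXn eqxx mul1r big1 ?add0r// => i _.
by rewrite coefXn ltn_eqF// mul0r.
Qed.

Lemma diffquoX u w : diffquo u w 'X = tau u * tau w.
Proof. by rewrite -['X]expr1 diffquoXn big_ord1 !expr0 mul1r mulr1. Qed.

Lemma diffquoC u w c : diffquo u w c%:P = 0.
Proof.
have := diffquoXn u w 0; rewrite expr0 big_ord0 => d1.
by rewrite -[c%:P]mulr1 mul_polyC linearZ/= d1 mulr0.
Qed.

Lemma diffquo_linearr u P : scalar (fun w => diffquo u w P).
Proof.
move=> a x y; rewrite /diffquo mulr_sumr -big_split/=; apply: eq_bigr => i _.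
rewrite mulrCA -mulrDr; congr (_ * _).
rewrite mulr_sumr -big_split/=; apply: eq_bigr => j _.
by rewrite mulrDr -scalerAr linearP mulrDr mulrCA.
Qed.

Lemma diffquo_linearl w P : scalar (fun u => diffquo u w P).
Proof.
move=> a x y; rewrite /diffquo mulr_sumr -big_split/=; apply: eq_bigr => i _.
rewrite mulrCA -mulrDr; congr (_ * _).
rewrite mulr_sumr -big_split/=; apply: eq_bigr => j _.
by rewrite mulrDl -scalerAl linearP mulrDl mulrA.
Qed.

(** The Leibniz rule. On monomials it splits the sum over [a < m + n] at [m]; linearity in each
    polynomial does the rest. *)
Lemma diffquoM u w P Q : diffquo u w (P * Q) =
  diffquo u (horner_alg s Q * w) P + diffquo (u * horner_alg s P) w Q.
Proof.
have dXX m n : diffquo u w ('X^m * 'X^n) =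
    diffquo u (s ^+ n * w) 'X^m + diffquo (u * s ^+ m) w 'X^n.
  rewrite -exprD !diffquoXn big_split_ord/=; congr (_ + _); apply: eq_bigr => i _.
    by rewrite [s ^+ _ * (_ * w)]mulrA -exprD addnBAC.
  by rewrite -[u * _ * _]mulrA -exprD -addnS subnDl.
have dXQ m : diffquo u w ('X^m * Q) =
    diffquo u (horner_alg s Q * w) 'X^m + diffquo (u * s ^+ m) w Q.
  move: Q; apply: poly_scalar_ext.
  - by move=> a x y; rewrite mulrDr -scalerAr linearP.
  - move=> a x y; rewrite !linearP/= mulr_algl mulrDl -scalerAl diffquo_linearr; ring.
  - by move=> n; rewrite dXX rmorphXn/= horner_algX.
move: P; apply: poly_scalar_ext.
- by move=> a x y; rewrite mulrDl -scalerAl linearP.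
- move=> a x y; rewrite !linearP/= mulr_algl mulrDr -scalerAr diffquo_linearl; ring.
- by move=> n; rewrite dXQ rmorphXn/= horner_algX.
Qed.
End DifferenceQuotient.

(** * The Schwinger-Dyson equation for words in free semicircular elements *)

Section Words.
Variables (R : realType) (A : cstarAlgType R) (tau : {scalar A}).
Variables (J : finType) (s : J -> A) (v : J -> R[i]).
Hypothesis tau1 : tau 1 = 1.
Hypothesis s_free : free_family tau (fun j => polynomials_in (s j)).
(* The Schwinger-Dyson equation in one variable, which encodes that [s j] is
   semicircular of variance [v j]. *)
Hypothesis s_sd : forall j (P : {poly R[i]}),
  tau (s j * horner_alg (s j) P) = v j * diffquo tau (s j) 1 1 P.

(* The word [(j_1, P_1) ... (j_n, P_n)] stands for [P_1(s_{j_1}) ... P_n(s_{j_n})]. *)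
Local Notation word := (seq (J * {poly R[i]})).
Implicit Types (l : word) (f g : J -> R[i]).

Definition eval_block (x : J * {poly R[i]}) : A := horner_alg (s x.1) x.2.
Definition eval_word l : A := \prod_(x <- l) eval_block x.

Definition lin_comb f : A := \sum_j f j *: s j.

(* [(tau (x) tau) ((u (x) 1) dl (1 (x) w))] for the derivation [d] of the free
   algebra with [d (s j) = v j * f j (1 (x) 1)]. *)
Fixpoint word_diff f l (u w : A) : R[i] :=
  if l is x :: l' then
    v x.1 * f x.1 * diffquo tau (s x.1) u (eval_word l' * w) x.2
      + word_diff f l' (u * eval_block x) w
  else 0.

Lemma eval_word_cons x l : eval_word (x :: l) = eval_block x * eval_word l.
Proof. by rewrite /eval_word big_cons. Qed.

Lemma eval_word_cat l l' : eval_word (l ++ l') = eval_word l * eval_word l'.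
Proof. by rewrite /eval_word big_cat. Qed.

Lemma eval_word_nil : eval_word [::] = 1. Proof. by rewrite /eval_word big_nil. Qed.

Lemma word_diff_cat f l l' u w :
  word_diff f (l ++ l') u w = word_diff f l u (eval_word l' * w) + word_diff f l' (u * eval_word l) w.
Proof.
elim: l u => [|x l IH] u/=; first by rewrite add0r eval_word_nil mulr1.
by rewrite IH eval_word_cat eval_word_cons !mulrA addrA.
Qed.

Lemma word_diff_linearr f l u : scalar (word_diff f l u).
Proof.
move=> a x y; elim: l u => [|z l IH] u /=; first by rewrite mulr0 addr0.
by rewrite IH mulrDr -scalerAr diffquo_linearr; ring.
Qed.

(** By the Leibniz rule, [word_diff] depends on two neighbouring blocks with the same index only
    through their product. *)
Lemma word_diff_merge f l l' j P Q :
  word_diff f (l ++ (j, P) :: (j, Q) :: l') 1 1 = word_diff f (l ++ (j, P * Q) :: l') 1 1.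
Proof.
have blockM : eval_block (j, P * Q) = eval_block (j, P) * eval_block (j, Q) by rewrite /eval_block/= rmorphM.
rewrite !word_diff_cat /= !eval_word_cons blockM !mulrA diffquoM /eval_block/= !mulrA; ring.
Qed.

Lemma eval_word_merge l l' j P Q :
  eval_word (l ++ (j, P) :: (j, Q) :: l') = eval_word (l ++ (j, P * Q) :: l').
Proof. by rewrite !eval_word_cat !eval_word_cons /eval_block/= rmorphM !mulrA. Qed.

Lemma word_diff_linearl f l w : scalar (fun u => word_diff f l u w).
Proof.
move=> a; elim: l => [|z l IH] x y /=; first by rewrite mulr0 addr0.
by rewrite diffquo_linearl mulrDl -(scalerAl a x) IH; ring.
Qed.

(** Constants have derivative zero, so a constant in a block contributes only through the word with
    that block removed. *)
Lemma word_diff_const f l l' j P c :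
  word_diff f (l ++ (j, P + c%:P) :: l') 1 1 =
  word_diff f (l ++ (j, P) :: l') 1 1 + c * word_diff f (l ++ l') 1 1.
Proof.
have blockD : eval_block (j, P + c%:P) = c *: 1 + eval_block (j, P).
  by rewrite /eval_block/= rmorphD/= horner_algC addrC.
rewrite !word_diff_cat /= !eval_word_cons blockD linearD/= diffquoC addr0 !mulr1 mul1r.
rewrite mulrDl mulrDr -scalerAl -scalerAr mul1r mulr1 word_diff_linearr word_diff_linearl.
ring.
Qed.

Lemma eval_word_const l l' j P c :
  eval_word (l ++ (j, P + c%:P) :: l') = eval_word (l ++ (j, P) :: l') + c *: eval_word (l ++ l').
Proof.
rewrite !eval_word_cat !eval_word_cons /eval_block/= rmorphD/= horner_algC mulrDl mulrDr.
by rewrite mulr_algl scalerAr.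
Qed.

Definition centered l := forall x, x \in l -> tau (eval_block x) = 0.
Definition alternating l := sorted (fun i j => i != j) (map fst l).

Lemma tau_alternating l : l != [::] -> centered l -> alternating l ->
  tau (eval_word l) = 0.
Proof.
move=> l0 cl al; pose h x := (x.1, eval_block x).
have -> : eval_word l = \prod_(x <- map h l) x.2 by rewrite big_map.
apply: s_free; first by case: (l) l0.
- by move=> _ /mapP[x _ ->]; exists x.2.
- by move=> _ /mapP[x /cl ? ->].
- by move: al; rewrite /alternating !sorted_map.
Qed.

(** Centring the head changes the product by a multiple of [eval_word l], whose trace vanishes
    because [l] is nonempty. *)
Lemma tau_alternating_head j Q l : l != [::] -> centered l ->
  alternating ((j, Q) :: l) -> tau (horner_alg (s j) Q * eval_word l) = 0.
Proof.
move=> l0 cl al; set c := tau (horner_alg (s j) Q).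
have -> : horner_alg (s j) Q * eval_word l = eval_word ([::] ++ (j, Q) :: l) by rewrite eval_word_cons.
rewrite -[Q in LHS](subrK c%:P) eval_word_const linearD linearZ/=.
rewrite (tau_alternating l0 cl (path_sorted al)) mulr0 addr0.
apply: tau_alternating => // x; rewrite inE => /predU1P[->|/cl//].
by rewrite /eval_block/= rmorphB/= horner_algC linearB linearZ/= tau1 mulr1 subrr.
Qed.

Lemma tau_alternating_last j Q l : l != [::] -> centered l ->
  alternating (rcons l (j, Q)) -> tau (eval_word l * horner_alg (s j) Q) = 0.
Proof.
move=> l0 cl al; set c := tau (horner_alg (s j) Q).
have -> : eval_word l * horner_alg (s j) Q = eval_word (l ++ (j, Q) :: [::]).
  by rewrite eval_word_cat eval_word_cons eval_word_nil mulr1.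
rewrite -[Q in LHS](subrK c%:P) eval_word_const linearD linearZ/= cats0.
have al' : alternating l.
  by move: al; rewrite /alternating map_rcons -cats1 => /cat_sorted2[].
rewrite (tau_alternating l0 cl al') mulr0 addr0 cats1.
apply: tau_alternating; first by case: (l).
- move=> x; rewrite mem_rcons inE => /predU1P[->|/cl//].
  by rewrite /eval_block/= rmorphB/= horner_algC linearB linearZ/= tau1 mulr1 subrr.
- by move: al; rewrite /alternating !map_rcons.
Qed.

(** Differentiating a letter behind the nonempty prefix [p] leaves on the left a product ending in a
    power of that letter; its trace vanishes by [tau_alternating_last]. *)
Lemma word_diff_alternating f l p : p != [::] -> centered p -> centered l ->
  alternating (p ++ l) -> word_diff f l (eval_word p) 1 = 0.
Proof.
elim: l p => //= x l IH p p0 cp cl al.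
have -> : eval_word p * eval_block x = eval_word (rcons p x).
  by rewrite -cats1 eval_word_cat eval_word_cons eval_word_nil mulr1.
rewrite IH ?cat_rcons//; first last.
- by move=> y yl; apply: cl; rewrite inE yl orbT.
- by move=> y; rewrite mem_rcons inE => /predU1P[->|/cp//]; apply: cl; rewrite mem_head.
- by case: (p).
rewrite addr0 /diffquo big1 ?mulr0// => i _; rewrite big1 ?mulr0// => a _.
have -> : s x.1 ^+ a = horner_alg (s x.1) 'X^a by rewrite rmorphXn/= horner_algX.
rewrite tau_alternating_last ?mul0r//.
move: al; rewrite /alternating map_rcons -cat_rcons map_cat map_rcons.
by move=> /cat_sorted2[].
Qed.

Lemma tau_gen j : tau (s j) = 0.
Proof.
by have := s_sd j 1; rewrite rmorph1 mulr1 => ->; rewrite diffquoC mulr0.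
Qed.

(** Only the generator with the index of the first block can contribute on the left, only the
    derivative of the first block on the right. If further blocks follow, both of these vanish by
    freeness; otherwise the equation is [s_sd]. *)
Lemma tau_lin_alternating f l : centered l -> alternating l ->
  tau (lin_comb f * eval_word l) = word_diff f l 1 1.
Proof.
move=> cl al; rewrite mulr_suml linear_sum/=.
under eq_bigr do rewrite -scalerAl linearZ/=.
case: l cl al => [|[j P] l] cl al.
  by rewrite eval_word_nil big1// => j _; rewrite mulr1 tau_gen mulr0.
have cl' : centered l by move=> y yl; apply: cl; rewrite inE yl orbT.
rewrite (bigD1 j)//= big1 ?addr0; last first.
  move=> i ij; rewrite -{1}(horner_algX (s i)) tau_alternating_head ?mulr0//.
  by rewrite /alternating/= ij.
have -> : 1 * eval_block (j, P) = eval_word [:: (j, P)] by rewrite eval_word_cons eval_word_nil mulr1 mul1r.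
rewrite word_diff_alternating ?addr0//; last first.
  by move=> x; rewrite inE => /eqP->; apply: cl; rewrite mem_head.
have [->|l0] := eqVneq l [::].
  by rewrite eval_word_cons eval_word_nil !mulr1 s_sd; ring.
rewrite eval_word_cons mulrA -{1}(horner_algX (s j)) -rmorphM/= tau_alternating_head// mulr0.
rewrite /diffquo big1 ?mulr0// => i _; rewrite big1 ?mulr0// => a _.
have -> : s j ^+ (i - a.+1) = horner_alg (s j) 'X^(i - a.+1).
  by rewrite rmorphXn/= horner_algX.
by rewrite mulr1 [X in _ * X]tau_alternating_head ?mulr0.
Qed.

(* Merging equal neighbours and subtracting traces shortens a word, hence
   reduces the identity to alternating centered words. *)
Lemma schwinger_dyson f l : tau (lin_comb f * eval_word l) = word_diff f l 1 1.
Proof.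
have [n] := ubnP (size l); elim: n l => // n IHn.
(* [p] is the part of the word already centred. The inner induction on [l] extends it by one letter;
   a merge or a deleted letter shortens the word and falls to the outer induction on length. *)
suff main l p : centered p -> (size (p ++ l) < n.+1)%N ->
    tau (lin_comb f * eval_word (p ++ l)) = word_diff f (p ++ l) 1 1.
  by move=> l ln; apply: (main l [::]).
elim: l p => [|[j P] l IHl] p cp; rewrite ?cats0 => pn.
  have [ap|] := boolP (alternating p); first exact: tau_lin_alternating.
  move=> nap.
  have [p1 [p2 [j [P [Q pE]]]]] : exists p1 p2 j P Q,
      p = p1 ++ (j, P) :: (j, Q) :: p2.
    elim: p nap {cp pn} => // -[i P] [|[j Q] p] //= IHp.
    rewrite /alternating/= negb_and negbK => /orP[/eqP->|/IHp[p1 [p2 [k [S [T ->]]]]]].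
      by exists [::], p, j, P, Q.
    by exists ((i, P) :: p1), p2, k, S, T.
  rewrite pE eval_word_merge word_diff_merge IHn//.
  by move: pn; rewrite pE !size_cat/= !addnS.
set c := tau (horner_alg (s j) P).
rewrite -[P](subrK c%:P) eval_word_const word_diff_const mulrDr linearD/= -scalerAr linearZ/=.
congr (_ + _ * _).
  rewrite -cat_rcons IHl ?cat_rcons//.
    move=> x; rewrite mem_rcons inE => /predU1P[->|/cp//].
    by rewrite /eval_block/= rmorphB/= horner_algC linearB linearZ/= tau1 mulr1 subrr.
  by move: pn; rewrite !size_cat.
by apply: IHn; move: pn; rewrite !size_cat/= addnS.
Qed.

Definition covariance f g : R[i] := \sum_j v j * f j * g j.

(* [e u] collects the terms of the Schwinger-Dyson equation for [u * y] in which
   the differentiated letter lies in [y]. *)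
Definition sd_rule f (y : A) (e : A -> R[i]) : Prop :=
  scalar e /\ forall l, tau (lin_comb f * (eval_word l * y)) = word_diff f l 1 y + e (eval_word l).

Lemma sd_rule_ext f y e e' : e =1 e' -> sd_rule f y e -> sd_rule f y e'.
Proof. by move=> ee' [le H]; split=> [a x z|l]; rewrite -!ee' ?le ?H. Qed.

Lemma sd_rule1 f : sd_rule f 1 (fun=> 0).
Proof.
split=> [a x y|l]; first by rewrite mulr0 addr0.
by rewrite mulr1 schwinger_dyson addr0.
Qed.

Lemma sd_rule_sum f (I : Type) (r : seq I) (a : I -> R[i]) (y : I -> A)
    (e : I -> A -> R[i]) : (forall i, sd_rule f (y i) (e i)) ->
  sd_rule f (\sum_(i <- r) a i *: y i) (fun u => \sum_(i <- r) a i * e i u).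
Proof.
move=> H; split=> [b x z|l].
  rewrite mulr_sumr -big_split/=; apply: eq_bigr => i _.
  by rewrite (proj1 (H i)) mulrDr mulrCA.
rewrite !mulr_sumr linear_sum (scalar_sum _ _ _ _ (word_diff_linearr _ _ _)) -big_split/=.
apply: eq_bigr => i _.
by rewrite -!scalerAr linearZ/= (proj2 (H i)) mulrDr.
Qed.

(** The letter passes from the word to [y]; its derivative is constant and cuts the product there
    into [tau u * tau y]. *)
Lemma sd_rule_gen f j y e : sd_rule f y e ->
  sd_rule f (s j * y) (fun u => e (u * s j) + v j * f j * tau u * tau y).
Proof.
move=> [le H]; split=> [a x z|l].
  by rewrite mulrDl -scalerAl le linearP/=; ring.
have lE : eval_word (rcons l (j, 'X)) = eval_word l * s j.
  by rewrite -cats1 eval_word_cat eval_word_cons eval_word_nil mulr1 /eval_block/= horner_algX.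
have := H (rcons l (j, 'X)).
rewrite lE -[eval_word l * _ * _]mulrA => ->; rewrite -cats1 word_diff_cat /= !eval_word_cons eval_word_nil.
by rewrite /eval_block/= horner_algX mulr1 mul1r addr0 mul1r diffquoX; ring.
Qed.

Lemma sd_rule_lin f g y e : sd_rule f y e ->
  sd_rule f (lin_comb g * y) (fun u => e (u * lin_comb g) + covariance f g * tau u * tau y).
Proof.
move=> H; rewrite mulr_suml; under eq_bigr do rewrite -scalerAl.
apply: sd_rule_ext (sd_rule_sum _ g (fun j => sd_rule_gen j H)) => u /=.
rewrite mulr_sumr; under [in RHS]eq_bigr do rewrite -scalerAr.
rewrite (scalar_sum _ _ _ _ (proj1 H)) /covariance !mulr_suml -big_split/=.
by apply: eq_bigr => j _; ring.
Qed.

Definition sd_mx f m n (Y : 'M[A]_(m, n)) (e : 'I_m -> 'I_n -> A -> R[i]) :=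
  forall i j, sd_rule f (Y i j) (e i j).

Lemma sd_mx_lin f m n q (X : 'M[A]_(m, n)) gX (Y : 'M[A]_(n, q)) e :
  (forall i k, X i k = lin_comb (gX i k)) -> sd_mx f Y e ->
  sd_mx f (X *m Y) (fun i j u =>
    \sum_k (e k j (u * X i k) + covariance f (gX i k) * tau u * tau (Y k j))).
Proof.
move=> XE H i j; rewrite mxE.
have := sd_rule_sum (index_enum 'I_n) (fun=> 1) (fun k => sd_rule_lin (gX i k) (H k j)).
under eq_bigr do rewrite scale1r -XE.
by apply: sd_rule_ext => u; apply: eq_bigr => k _; rewrite mul1r XE.
Qed.

(** Since [f] has covariance zero with [Q], only the [N.+1] factors [P] are differentiated; the
    [k]-th one leaves [(P *m Q) ^+ k] on its left and [(Q *m P) ^+ (N - k)] on its right. The prefix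
    [u] is arbitrary because the induction peels factors from the left into it. *)
Lemma sd_mx_alternating f m n (P : 'M[A]_(m, n)) gP (Q : 'M[A]_(n, m)) gQ
    (b : 'I_m -> R[i]) (a : 'I_n) N :
  (forall i k, P i k = lin_comb (gP i k)) -> (forall k i, Q k i = lin_comb (gQ k i)) ->
  (forall i k, covariance f (gP i k) = b i * (k == a)%:R) ->
  (forall k i, covariance f (gQ k i) = 0) ->
  sd_mx f (P *m (Q *m P) ^+ N) (fun i j u => \sum_(k < N.+1)
    (\sum_h tau (u * ((P *m Q) ^+ k) i h) * b h) * tau (((Q *m P) ^+ (N - k)) a j)).
Proof.
move=> PE QE covP covQ.
have stepP q (Y : 'M[A]_(n, q)) e : sd_mx f Y e -> sd_mx f (P *m Y) (fun i j u =>
    (\sum_k e k j (u * P i k)) + b i * tau u * tau (Y a j)).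
  move=> /(sd_mx_lin PE) H i j; apply: sd_rule_ext (H i j) => u.
  rewrite big_split/=; congr (_ + _); rewrite (bigD1 a)//= big1 => [|k ka].
    by rewrite covP eqxx mulr1 addr0.
  by rewrite covP (negPf ka) mulr0 !mul0r.
have stepQ q (Y : 'M[A]_(m, q)) e : sd_mx f Y e -> sd_mx f (Q *m Y) (fun i j u =>
    \sum_k e k j (u * Q i k)).
  move=> /(sd_mx_lin QE) H i j; apply: sd_rule_ext (H i j) => u.
  by apply: eq_bigr => k _; rewrite covQ !mul0r addr0.
elim: N => [|N IH].
  have H1 : sd_mx f (1%:M : 'M[A]_n) (fun _ _ _ => 0).
    move=> i j; rewrite mxE; case: (i == j); first exact: sd_rule1.
    split=> [x y z|l]; first by rewrite mulr0 addr0.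
    have := word_diff_linearr f l 1 (-1) 0 0; rewrite scaler0 addr0 mulN1r addNr.
    by rewrite !mulr0 linear0 addr0.
  move=> i j; apply: sd_rule_ext (stepP _ _ _ H1 i j) => u.
  rewrite big_ord1 big1// add0r !expr0.
  rewrite (bigD1 i)//= big1 ?addr0; last first.
    by move=> k ki; rewrite mxE eq_sym (negPf ki) mulr0 linear0 mul0r.
  by rewrite [X in u * X]mxE eqxx mulr1 [b i * _]mulrC.
rewrite exprS -mulmxE -mulmxA => i j.
apply: sd_rule_ext (stepP _ _ _ (stepQ _ _ _ IH) i j) => u.
(* The term [k = 0] differentiates the leading [P]; the others come from the induction hypothesis,
   with the entries of [P] and [Q] absorbed into [u]. *)
rewrite [RHS]big_ord_recl/= addrC; congr (_ + _).
  rewrite subn0 exprS -mulmxE mulmxA expr0.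
  rewrite [in RHS](bigD1 i)//= [in RHS]big1 ?addr0; last first.
    by move=> k ki; rewrite mxE eq_sym (negPf ki) mulr0 linear0 mul0r.
  by rewrite [X in u * X]mxE eqxx mulr1 [b i * _]mulrC.
rewrite /=; under eq_bigr do rewrite exchange_big/=.
rewrite exchange_big/=; apply: eq_bigr => t _; rewrite /bump/= add1n subSS.
under eq_bigr do rewrite -mulr_suml.
rewrite -mulr_suml; congr (_ * _).
have key h : tau (u * ((P *m Q) ^+ t.+1) i h) =
    \sum_k \sum_k' tau (u * P i k * Q k k' * ((P *m Q) ^+ t) k' h).
  rewrite exprS -mulmxE -mulmxA mxE mulr_sumr linear_sum; apply: eq_bigr => k _.
  rewrite mxE !mulr_sumr linear_sum; apply: eq_bigr => k' _.
  by rewrite !mulrA.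
under [RHS]eq_bigr do rewrite key mulr_suml.
rewrite [RHS]exchange_big/=; apply: eq_bigr => k _.
by rewrite exchange_big/=; apply: eq_bigr => h _; rewrite mulr_suml.
Qed.

Lemma sd_mx_trace f m n (P : 'M[A]_(m, n)) gP (Q : 'M[A]_(n, m)) gQ
    (b : 'I_m -> R[i]) (a : 'I_n) N i j :
  (forall i k, P i k = lin_comb (gP i k)) -> (forall k i, Q k i = lin_comb (gQ k i)) ->
  (forall i k, covariance f (gP i k) = b i * (k == a)%:R) ->
  (forall k i, covariance f (gQ k i) = 0) ->
  tau (lin_comb f * (P *m (Q *m P) ^+ N) i j) = \sum_(k < N.+1)
    (\sum_h tau (((P *m Q) ^+ k) i h) * b h) * tau (((Q *m P) ^+ (N - k)) a j).
Proof.
move=> PE QE covP covQ.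
have [_ /(_ [::])] := sd_mx_alternating N PE QE covP covQ i j.
rewrite eval_word_nil mul1r /= add0r => ->; apply: eq_bigr => k _; congr (_ * _).
by apply: eq_bigr => h _; rewrite mul1r.
Qed.
End Words.

(** * Moments of the semicircle law *)

Section Density.
Local Open Scope ereal_scope.
Context d (T : measurableType d) (R : realType).
Variables (mu nu : {measure set T -> \bar R}) (h : T -> R).
Hypothesis mh : measurable_fun [set: T] h.
Hypothesis h0 : forall x, (0 <= h x)%R.
Hypothesis nuE : forall E, measurable E -> nu E = \int[mu]_(x in E) (h x)%:E.

Import HBNNSimple.

(** Monotone convergence on both sides reduces to simple functions, and for the level sets of these
    the claim is [nuE]. *)
Lemma ge0_integral_density (f : T -> \bar R) : measurable_fun [set: T] f ->
  (forall x, 0 <= f x) -> \int[nu]_x f x = \int[mu]_x (f x * (h x)%:E).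
Proof.
move=> mf f0; pose f_ := nnsfun_approx measurableT mf.
have f_cvg x : (f_ n x)%:E @[n --> \oo] --> f x by exact: cvg_nnsfun_approx.
transitivity (limn (fun n => \int[nu]_x (f_ n x)%:E)).
  rewrite -monotone_convergence//.
  - by apply: eq_integral => y _; apply/esym/cvg_lim.
  - by move=> n; exact/measurable_EFinP/measurable_funP.
  - by move=> n y _; rewrite lee_fin.
  - by move=> y _ m n mn; rewrite lee_fin; exact/lefP/nd_nnsfun_approx.
rewrite [X in limn X](_ : _ = (fun n => \int[mu]_x ((f_ n x)%:E * (h x)%:E))).
  rewrite -monotone_convergence//.
  - apply: eq_integral => y _; apply/cvg_lim => //.
    by apply: cvgeZr => //; exact: f_cvg.
  - by move=> n; apply: emeasurable_funM; apply/measurable_EFinP => //; exact/measurable_funP.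
  - by move=> n x _ /=; rewrite mule_ge0 ?lee_fin.
  - move=> x _ m n mn; rewrite lee_pmul ?lee_fin//; exact/lefP/nd_nnsfun_approx.
apply/funext => n.
transitivity (\sum_(k \in range (f_ n)) (k%:E * nu (f_ n @^-1` [set k]))).
  under eq_integral do rewrite fimfunE -fsumEFin//.
  rewrite ge0_integral_fsum//; last 2 first.
  - by move=> y; exact/measurable_EFinP/measurable_funM.
  - by move=> y x _; rewrite nnfun_muleindic_ge0.
  apply: eq_fsbigr => r _; rewrite integralZl_indic_nnsfun//.
  by rewrite integral_indic// setIT.
transitivity (\int[mu]_x (\sum_(k \in range (f_ n))
    (k%:E * (\1_(f_ n @^-1` [set k]) x * h x)%:E))); last first.
  apply: eq_integral => x _; rewrite [X in _ = X%:E * _]fimfunE -fsumEFin// ge0_mule_fsuml.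
    by apply: eq_fsbigr => k _; rewrite !EFinM muleA.
  by move=> k; rewrite nnfun_muleindic_ge0.
rewrite ge0_integral_fsum//; last 2 first.
- move=> k; apply/measurable_EFinP; apply: measurable_funM => //.
  exact: measurable_funM.
- move=> k x _; rewrite EFinM muleA; apply: mule_ge0; rewrite ?lee_fin//.
  exact: nnfun_muleindic_ge0.
apply: eq_fsbigr => k /[!inE] -[x _ <-]; rewrite ge0_integralZl_EFin//; last 2 first.
- by move=> y _; rewrite lee_fin mulr_ge0.
- by apply/measurable_EFinP; exact: measurable_funM.
congr (_ * _); rewrite nuE// integral_mkcond; apply: eq_integral => y _.
by rewrite patchE indicE; case: ifPn => _; rewrite ?mul1r ?mul0r.
Qed.

(** Multiplication by [h], being nonnegative, commutes with taking positive and negative parts. *)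
Lemma integral_density (f : T -> \bar R) : measurable_fun [set: T] f ->
  \int[nu]_x f x = \int[mu]_x (f x * (h x)%:E).
Proof.
move=> mf; rewrite integralE [RHS]integralE; congr (_ - _).
  rewrite ge0_integral_density; [|exact: measurable_funepos|by []].
  apply: eq_integral => x _; rewrite !funeposE muleC [f x * _]muleC.
  by rewrite maxe_pMr ?mule0// lee_fin.
rewrite ge0_integral_density; [|exact: measurable_funeneg|by []].
apply: eq_integral => x _; rewrite !funenegE muleC [f x * _]muleC -muleN.
by rewrite maxe_pMr ?mule0// lee_fin.
Qed.
End Density.

Section Semicircle.
Variable R : realType.
Local Notation leb := (@lebesgue_measure R).
Implicit Types x : R.

Let q (x : R) : R := Num.sqrt (4 - x ^+ 2).

Lemma continuous_semicircle_weight n : continuous (fun x => x ^+ n * q x).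
Proof.
move=> x; apply: cvgM; first exact: exprn_continuous.
apply: (@continuous_comp _ _ _ (fun y : R => 4 - y ^+ 2) Num.sqrt); last exact: sqrt_continuous.
by apply: cvgB; [exact: cvg_cst|exact: exprn_continuous].
Qed.

(** The integrand is the derivative of [x ^+ n * q x ^+ 3], which vanishes at both endpoints. The
    cube makes this derivative a polynomial multiple of [q], hence continuous up to the
    endpoints. *)
Lemma semicircle_weight_ibp n :
  (\int[leb]_(x in `[(-2)%R, 2%R])
    ((x ^+ n.-1 * q x) * (4 * n%:R) - (x ^+ n.+1 * q x) * n.+3%:R)%:E = 0)%E.
Proof.
have mem_lt2 x : x \in `](-2)%R, 2%R[ -> 0 < 4 - x ^+ 2.
  by rewrite in_itv/= => /andP[x1 x2]; rewrite subr_gt0; nra.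
pose F x := x ^+ n * q x ^+ 3.
have dF x : x \in `](-2)%R, 2%R[ -> is_derive x 1 F
    ((x ^+ n.-1 * q x) * (4 * n%:R) - (x ^+ n.+1 * q x) * n.+3%:R).
  move=> /mem_lt2 x4.
  have q0 : 0 < q x by rewrite sqrtr_gt0.
  have qq : q x ^+ 2 = 4 - x ^+ 2 by rewrite sqr_sqrtr// ltW.
  have dr : is_derive x 1 (fun y : R => 4 - y ^+ 2) (- (2 * x)).
    by apply: is_derive_eq; rewrite /GRing.scale/=; ring.
  have dq : is_derive x 1 q ((2 * q x)^-1 * - (2 * x)).
    exact: (@is_derive1_comp _ Num.sqrt (fun y : R => 4 - y ^+ 2) x
      ((2 * q x)^-1) (- (2 * x)) (is_derive1_sqrt x4) dr).
  have dX : is_derive x 1 (fun y : R => y ^+ n) (n%:R * x ^+ n.-1).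
    split; first exact: exprn_derivable.
    by rewrite exp_derive /GRing.scale/= mulr1.
  have dq3 : is_derive x 1 (fun y => q y ^+ 3) (3 * q x ^+ 2 * ((2 * q x)^-1 * - (2 * x))).
    have -> : (fun y => q y ^+ 3) = q * (q * q) by apply/funext => y; rewrite !exprS expr0 mulr1.
    apply: is_derive_eq; rewrite /GRing.scale/=.
    by rewrite [(q * q) x](_ : _ = q x * q x)//; set w := (2 * q x)^-1; ring.
  have -> : F = (fun y : R => y ^+ n) * (fun y => q y ^+ 3) by [].
  apply: is_derive_eq; rewrite /GRing.scale/=.
  have -> : 3 * q x ^+ 2 * ((2 * q x)^-1 * - (2 * x)) = - 3 * x * q x.
    by field; rewrite gt_eqF.
  have -> : q x ^+ 3 = q x * (4 - x ^+ 2) by rewrite -qq exprS.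
  case: (n) => [|m]/=; first by rewrite expr0 expr1; ring.
  by rewrite !exprS -!natr1; ring.
have cF : continuous F.
  move=> x; rewrite /F.
  have -> : (fun x => x ^+ n * q x ^+ 3) = (fun x => (x ^+ n * q x) * (x ^+ 0 * q x) ^+ 2).
    by apply/funext => y; rewrite expr0; ring.
  apply: cvgM; first exact: continuous_semicircle_weight.
  apply: (@continuous_comp _ _ _ (fun y : R => y ^+ 0 * q y) (fun y => y ^+ 2)).
    exact: continuous_semicircle_weight.
  exact: exprn_continuous.
have q2 : q 2 = 0 by rewrite /q [X in Num.sqrt X](_ : _ = 0) ?sqrtr0//; ring.
have qN2 : q (-2) = 0 by rewrite /q [X in Num.sqrt X](_ : _ = 0) ?sqrtr0//; ring.
rewrite (@continuous_FTC2 _ _ F).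
- by rewrite /F q2 qN2 expr0n/= !mulr0 subee.
- lra.
- apply: continuous_subspaceT => x; apply: cvgB; apply: cvgMl; exact: continuous_semicircle_weight.
- split.
  + by move=> x /dF[].
  + exact/cvg_at_right_filter/cF.
  + exact/cvg_at_left_filter/cF.
- by move=> x /dF ?; rewrite derive1E derive_val.
Qed.

(** For [n = 0] the right-hand side has coefficient 0, whatever [n.-1] means there, so this includes
    the vanishing of the first moment. *)
Lemma semicircle_moment_rec n :
  n.+3%:R * \int[@semicircle_measure R]_x (x ^+ n.+1) =
  4 * n%:R * \int[@semicircle_measure R]_x (x ^+ n.-1).
Proof.
pose w := (2 * pi : R)^-1.
have iq k : leb.-integrable `[(-2)%R, 2%R] (EFin \o (fun x => x ^+ k * q x)).
  apply: continuous_compact_integrable; first exact: segment_compact.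
  by apply: continuous_subspaceT; exact: continuous_semicircle_weight.
have mE k : \int[@semicircle_measure R]_x (x ^+ k) =
    w * \int[leb]_(x in `[(-2)%R, 2%R]) (x ^+ k * q x).
  rewrite -RintegralZl// /Rintegral; congr fine.
  rewrite (@integral_density _ _ _ leb _ (@semicircle_pdf R))//.
  - rewrite [RHS]integral_mkcond; apply: eq_integral => x _.
    rewrite patchE -EFinM /semicircle_pdf indicE; case: ifPn => _; congr EFin.
      by rewrite /w /q mul1r [RHS]mulrC mulrA.
    by rewrite mul0r mulr0.
  - exact: measurable_semicircle_pdf.
  - exact: semicircle_pdf_ge0.
  - by apply/measurable_EFinP; exact: exprn_measurable.
have iq' k c : leb.-integrable `[(-2)%R, 2%R] (EFin \o (fun x => x ^+ k * q x * c)).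
  have -> : EFin \o (fun x => x ^+ k * q x * c) = (fun x => c%:E * (x ^+ k * q x)%:E)%E.
    by apply/funext => x; rewrite /= mulrC EFinM.
  by apply: integrableZl => //; exact: iq.
have := congr1 fine (semicircle_weight_ibp n).
rewrite -[fine _]/(\int[leb]_(x in _) _) RintegralB//.
rewrite !RintegralZr//= => /eqP; rewrite subr_eq0 => /eqP h.
by rewrite !mE mulrCA [n.+3%:R * _]mulrC -h; ring.
Qed.
End Semicircle.

(** * Free circular families *)

(* Weighting the convolution by [a + 2], the recursion lowers the index by two,
   while symmetry in [a] and [n - a] turns the weight into [(n + 4) / 2]. *)
Lemma catalan_convolution (K : numFieldType) (m : nat -> K) :
  m 0 = 1 -> m 1 = 0 -> (forall n, n.+4%:R * m n.+2 = 4 * n.+1%:R * m n) ->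
  forall n, m n.+2 = \sum_(a < n.+1) m a * m (n - a)%N.
Proof.
move=> m0 m1 mrec.
pose T n := \sum_(a < n.+1) m a * m (n - a)%N.
have sym n : 2 * \sum_(a < n.+1) a%:R * (m a * m (n - a)%N) = n%:R * T n.
  rewrite mulr_natl mulr2n [X in _ + X](reindex_inj rev_ord_inj)/= -big_split/=.
  rewrite /T mulr_sumr; apply: eq_bigr => a _.
  have an : (a <= n)%N by rewrite -ltnS.
  rewrite subSS (subKn an) [m (n - a)%N * m a]mulrC -mulrDl.
  by rewrite -natrD subnKC.
have symc n c : 2 * \sum_(a < n.+1) (a%:R + c) * (m a * m (n - a)%N) =
    (n%:R + 2 * c) * T n.
  under eq_bigr do rewrite mulrDl.
  by rewrite big_split/= -mulr_sumr mulrDr sym -/(T n); ring.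
have n4 n : n.+4%:R != 0 :> K by rewrite pnatr_eq0.
suff H n : m n.+2 = T n /\ m n.+3 = T n.+1 by move=> n; have [] := H n.
elim: n => [|n [IH IH']].
  split; [apply: (mulfI (n4 0))|apply: (mulfI (n4 1))]; rewrite mrec /T !big_ord_recr big_ord0/=.
    by rewrite m0; ring.
  by rewrite m1; ring.
split=> //; apply: (mulfI (n4 n.+2)); rewrite mrec.
(* The terms [a = 0] and [a = 1] are split off; in the others [(a + 2) m_a = 4 (a - 1) m_(a-2)], and
   symmetry with shift 1 turns their sum into a multiple of [T n], known by induction. *)
have := symc n.+2 2.
rewrite (big_ord_recl n.+2) (big_ord_recl n.+1)/= /bump/= m1 mul0r mulr0 !add0r m0 mul1r subn0.
have -> : \sum_(i < n.+1) ((1 + (1 + i))%N%:R + 2) * (m (1 + (1 + i))%N * m (n.+2 - (1 + (1 + i)))%N)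
   = 4 * \sum_(i < n.+1) (i%:R + 1) * (m i * m (n - i)%N).
  rewrite mulr_sumr; apply: eq_bigr => i _; rewrite !add1n !subSS mulrA.
  have -> : i.+2%:R + 2 = i.+4%:R :> K by rewrite -!natr1; ring.
  by rewrite mrec -natr1; ring.
rewrite mulrDr [2 * (4 * _)]mulrCA symc -IH => h.
have -> : n.+2.+4%:R = n.+2%:R + 2 * 2 :> K.
  by rewrite -natrM -natrD; congr _%:R; lia.
by rewrite -h -[n.+3]addn3 natrD; ring.
Qed.

Section SemicircularElements.
Variables (R : realType) (A : cstarAlgType R) (tau : {scalar A}).
Hypothesis tau1 : tau 1 = 1.

(** On monomials this is the Catalan convolution of the moments; homogeneity produces the factor
    [c ^+ 2]. *)
Lemma semicircular_sd (s : A) (c : R[i]) (P : {poly R[i]}) :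
  standard_semicircular tau s ->
  tau ((c *: s) * horner_alg (c *: s) P) = c ^+ 2 * diffquo tau (c *: s) 1 1 P.
Proof.
move=> [_ [_ _ sm]].
have m0 : tau (s ^+ 0) = 1 by rewrite expr0.
have m1 : tau (s ^+ 1) = 0.
  rewrite -sm; have := semicircle_moment_rec R 0; rewrite mulr0 mul0r => /eqP.
  by rewrite mulf_eq0 pnatr_eq0/= => /eqP ->.
have mrec n : n.+4%:R * tau (s ^+ n.+2) = 4 * n.+1%:R * tau (s ^+ n).
  have /(congr1 (real_complex R)) := semicircle_moment_rec R n.+1.
  by rewrite !rmorphM !rmorph_nat/= -!sm.
have conv := catalan_convolution m0 m1 mrec.
move: P; apply: poly_scalar_ext.
- by move=> a x y; rewrite linearP/= mulr_algl mulrDr -scalerAr linearP.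
- by move=> a x y; rewrite linearP/=; ring.
move=> [|n]; rewrite diffquoXn rmorphXn/= horner_algX.
  by rewrite big_ord0 mulr0 expr0 mulr1 linearZ/= -[s]expr1 m1 mulr0.
rewrite -exprS exprZn linearZ/= conv !mulr_sumr; apply: eq_bigr => a _.
rewrite mul1r mulr1 !exprZn !linearZ/= subSS.
have -> : c ^+ n.+2 = c ^+ 2 * (c ^+ a * c ^+ (n - a)).
  by rewrite -!exprD subnKC// -ltnS.
by ring.
Qed.

Hypothesis tauC : forall a b, tau (a * b) = tau (b * a).

Lemma semicircular_var (s : A) : standard_semicircular tau s -> tau (s * s) = 1.
Proof.
move=> /(semicircular_sd 1 'X); rewrite scale1r horner_algX diffquoX.
by rewrite tau1 expr1n !mulr1.
Qed.

Lemma half_double (x : A) : 2^-1 *: (x + x) = x.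
Proof.
by rewrite -mulr2n -[x *+ 2]scaler_nat scalerA mulVf ?scale1r// pnatr_eq0.
Qed.

Lemma re_imK (c : A) : re_part c + 'i *: im_part c = c.
Proof.
rewrite /re_part /im_part scalerA invfM mulrCA mulfV ?neq0Ci// mulr1 -scalerDr.
by rewrite addrACA subrr addr0 half_double.
Qed.

Lemma re_im_star (c : A) : re_part c + (- 'i) *: im_part c = star c.
Proof.
rewrite /re_part /im_part scalerA mulNr invfM mulrCA mulfV ?neq0Ci// mulr1 scaleNr.
rewrite -scalerBr opprB [c + _]addrC addrACA subrr addr0.
exact: half_double.
Qed.

(** One real factor [k] serves both parts. In [tau (star c * c)] the cross terms [s1 * s2] and
    [s2 * s1] cancel by traciality, leaving two variances equal to 1. *)
Lemma circular_parts (v : R) (c : A) : circular_of_variance tau v c ->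
  exists s1 s2 (k : R[i]), [/\ standard_semicircular tau s1,
    standard_semicircular tau s2, re_part c = k *: s1, im_part c = k *: s2
    & tau (star c * c) = 2 * k ^+ 2].
Proof.
move=> [s1 [s2 [h1 h2 _ cE]]]; exists s1, s2.
set k := (_ / _)%:C in cE; exists k.
have kc : Num.conj k = k by rewrite conj_Creal// complex_real.
have scE : star c = k *: (s1 - 'i *: s2).
  rewrite cE starZ kc starD starZ conjCi.
  by rewrite (proj1 h1) (proj1 h2) scaleNr.
split => //.
- by rewrite /re_part scE cE -scalerDr addrACA subrr addr0 scalerA mulrC -scalerA half_double.
- rewrite /im_part scE cE -scalerBr opprB [s1 + _]addrC addrACA subrr addr0.
  rewrite scalerA mulrC -scalerA -scalerDr invfM mulrC -scalerA scalerA.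
  by rewrite scalerDr half_double scalerA divfK ?neq0Ci.
- rewrite scE cE -scalerAl -scalerAr scalerA linearZ/= -expr2.
  rewrite mulrBl !mulrDr -!scalerAl -!scalerAr scalerA -['i * 'i]expr2 sqrCi scaleN1r.
  rewrite !(linearD, linearB, linearZ, linearN)/= (semicircular_var h1) (semicircular_var h2).
  by rewrite [tau (s2 * s1)]tauC /GRing.scale/=; ring.
Qed.

Lemma circular_parts_sd (c : A) (P : {poly R[i]}) : circular tau c ->
  (tau (re_part c * horner_alg (re_part c) P) =
     tau (star c * c) / 2 * diffquo tau (re_part c) 1 1 P) /\
  (tau (im_part c * horner_alg (im_part c) P) =
     tau (star c * c) / 2 * diffquo tau (im_part c) 1 1 P).
Proof.
move=> [v _ /circular_parts[s1 [s2 [k [h1 h2 -> -> ->]]]]].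
have -> : 2 * k ^+ 2 / 2 = k ^+ 2 by field.
by split; exact: semicircular_sd.
Qed.
End SemicircularElements.

(** * The two recursions for the moments of a free Wishart matrix *)

Section WishartRecursion.
Variables (R : realType) (A : cstarAlgType R) (tau : {scalar A}).
Hypothesis tau1 : tau 1 = 1.
Hypothesis tauC : forall a b, tau (a * b) = tau (b * a).
Variables (p d : nat) (C : 'M[A]_(p, d)).
Hypothesis hC : star_free_circular tau (fun ij : 'I_p * 'I_d => C ij.1 ij.2).
Hypothesis hvar : forall i j, tau (star (C i j) * C i j) = d%:R^-1.

Let J : finType := (('I_p * 'I_d) * bool)%type.
Let s (t : J) : A := if t.2 then re_part (C t.1.1 t.1.2) else im_part (C t.1.1 t.1.2).
(** Each of the two self-adjoint parts of an entry carries half of its variance [1/d]. *)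
Let v (_ : J) : R[i] := d%:R^-1 / 2.

Let s_free : free_family tau (fun t => polynomials_in (s t)).
Proof. exact: (proj2 (proj2 hC)). Qed.

Let s_sd (t : J) (P : {poly R[i]}) :
  tau (s t * horner_alg (s t) P) = v t * diffquo tau (s t) 1 1 P.
Proof.
have [re im] := circular_parts_sd tau1 tauC P (proj1 hC t.1).
by rewrite /s /v -(hvar t.1.1 t.1.2); case: t.2.
Qed.

(* [letter 'i i j] and [letter (- 'i) i j] are the coordinates of [C i j] and of
   its adjoint. *)
Let letter (z : R[i]) (i : 'I_p) (j : 'I_d) (t : J) : R[i] :=
  (t.1 == (i, j))%:R * (if t.2 then 1 else z).

Let letter_sum (V : lmodType R[i]) z i j (F : J -> V) :
  \sum_t letter z i j t *: F t = F ((i, j), true) + z *: F ((i, j), false).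
Proof.
transitivity (\sum_(t : J) letter z i j (t.1, t.2) *: F (t.1, t.2)).
  by apply: eq_bigr => -[].
rewrite -(pair_bigA _ (fun x b => letter z i j (x, b) *: F (x, b)))/=.
rewrite (bigD1 (i, j))//= [X in _ + X]big1 ?addr0; last first.
  by move=> x xij; rewrite big_bool /letter/= (negPf xij) !mul0r !scale0r addr0.
by rewrite big_bool /letter/= eqxx !mul1r scale1r.
Qed.

Let letterC i j : C i j = lin_comb s (letter 'i i j).
Proof. by rewrite /lin_comb letter_sum /s/= re_imK. Qed.

Let letter_star i j : star_mx C j i = lin_comb s (letter (- 'i) i j).
Proof. by rewrite /lin_comb letter_sum /s/= re_im_star !mxE. Qed.

(** The factor [1 + z * w] is 2 for an entry against its adjoint, where [z * w = - 'i ^+ 2 = 1], and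
    0 for two entries or two adjoints, where [z * w = -1]. *)
Let cov_letter z w i j i' j' : covariance v (letter z i j) (letter w i' j') =
  (i == i')%:R * (j == j')%:R * (d%:R^-1 / 2 * (1 + z * w)).
Proof.
rewrite /covariance.
under eq_bigr do rewrite [v _ * _]mulrC -mulrA.
have /= -> := letter_sum z i j (fun t => v t * letter w i' j' t : R[i]^o).
rewrite /letter/= xpair_eqE /v -natrM mulnb /GRing.scale/=; ring.
Qed.

Variable D : 'M[R[i]]_p.
Let DA : 'M[A]_p := map_mx (in_alg A) D.
Let P : 'M[A]_(p, d) := DA *m C.
Let Q : 'M[A]_(d, p) := star_mx C.

Definition wishart_moment (n : nat) : R[i] := tr_state tau (wishart C D ^+ n).
Definition dual_moment (n : nat) : 'M[R[i]]_p :=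
  map_mx tau ((DA *m C *m star_mx C) ^+ n).

Let WE : wishart C D = Q *m P. Proof. by rewrite /wishart mulmxA. Qed.

Let letterP (i : 'I_p) (k : 'I_d) : J -> R[i] := fun t => \sum_h D i h * letter 'i h k t.

Let letterPE i k : P i k = lin_comb s (letterP i k).
Proof.
rewrite mxE /lin_comb; under [RHS]eq_bigr do rewrite scaler_suml.
rewrite exchange_big/=; apply: eq_bigr => h _.
rewrite !mxE mulr_algl letterC /lin_comb scaler_sumr.
by apply: eq_bigr => t _; rewrite scalerA.
Qed.

Let cov_letterP f i k : covariance v f (letterP i k) = \sum_h D i h * covariance v f (letter 'i h k).
Proof.
rewrite /covariance; under [RHS]eq_bigr do rewrite mulr_sumr.
rewrite exchange_big/=; apply: eq_bigr => t _.
by rewrite mulr_sumr; apply: eq_bigr => h _; ring.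
Qed.

Let twice_half : d%:R^-1 / 2 * (1 + 1) = d%:R^-1 :> R[i].
Proof. by rewrite -mulrA [2^-1 * _]mulrC mulfV ?mulr1// pnatr_eq0. Qed.

(** The leading letter is an entry of [star_mx C]; it pairs with the factors [C] inside [P], each of
    which brings the [D] in front of it. Summing over the row indices yields the trace against
    [D]. *)
Lemma wishart_moment_rec n : wishart_moment n.+1 =
  d%:R^-1 * \sum_(k < n.+1) \tr (dual_moment k *m D) * wishart_moment (n - k).
Proof.
have key a a' b : tau (Q a b * (P *m (Q *m P) ^+ n) b a') = \sum_(k < n.+1)
    (\sum_h tau (((P *m Q) ^+ k) b h) * (D h b / d%:R)) * tau (((Q *m P) ^+ (n - k)) a a').
  rewrite letter_star; apply: (sd_mx_trace tau1 s_free s_sd).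
  - exact: letterPE.
  - by move=> k i; exact: letter_star.
  - move=> i k; rewrite cov_letterP (bigD1 b)//= big1 ?addr0; last first.
      by move=> h hb; rewrite cov_letter eq_sym (negPf hb) !mul0r mulr0.
    rewrite cov_letter eqxx mul1r [a == k]eq_sym mulNr -expr2 sqrCi opprK twice_half.
    by rewrite -mulrA; congr (_ * _); rewrite mulrC.
  - by move=> k i; rewrite cov_letter mulrNN -expr2 sqrCi subrr !mulr0.
rewrite /wishart_moment /tr_state WE; congr (_ * _).
transitivity (\sum_a \sum_(k < n.+1) \sum_b
    (\sum_h tau (((P *m Q) ^+ k) b h) * (D h b / d%:R)) * tau (((Q *m P) ^+ (n - k)) a a)).
  apply: eq_bigr => a _; rewrite exprS -mulmxE -mulmxA mxE linear_sum/=.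
  by under eq_bigr do rewrite key; rewrite exchange_big.
rewrite exchange_big/=; apply: eq_bigr => k _.
under eq_bigr do rewrite -mulr_suml.
rewrite -mulr_sumr mulrA; congr (_ * _).
rewrite /mxtrace mulr_suml; apply: eq_bigr => b _.
by rewrite mxE mulr_suml; apply: eq_bigr => h _; rewrite mxE mulrA.
Qed.

Lemma dual_moment0 : dual_moment 0 = 1%:M.
Proof.
apply/matrixP => i j; rewrite /dual_moment expr0 !mxE.
by case: (i == j); rewrite ?tau1 ?linear0.
Qed.

(** Behind the leading scalar matrix [D] stands an entry of [C], which pairs only with the factors
    [Q]: the cut formula applies with [P] and [Q] exchanged. *)
Lemma dual_moment_rec n : dual_moment n.+1 =
  \sum_(l < n.+1) wishart_moment l *: (D *m dual_moment (n - l)).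
Proof.
have key i j b : tau (C i j * (Q *m (P *m Q) ^+ n) j b) = \sum_(l < n.+1)
    (\sum_h tau (((Q *m P) ^+ l) j h) * ((h == j)%:R / d%:R)) * tau (((P *m Q) ^+ (n - l)) i b).
  rewrite letterC; apply: (sd_mx_trace tau1 s_free s_sd).
  - by move=> k i'; exact: letter_star.
  - exact: letterPE.
  - move=> k i'; rewrite cov_letter [k == j]eq_sym [i' == i]eq_sym mulrN -expr2 sqrCi opprK.
    by rewrite twice_half; ring.
  - move=> k i'; rewrite cov_letterP big1// => h _.
    by rewrite cov_letter -expr2 sqrCi subrr !mulr0.
apply/matrixP => i b; rewrite summxE mxE -/P -/Q exprS -mulmxE -(mulmxA P) -(mulmxA DA) mxE linear_sum/=.
transitivity (\sum_h D i h * \sum_(l < n.+1)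
    wishart_moment l * tau (((P *m Q) ^+ (n - l)) h b)).
  apply: eq_bigr => h _; rewrite mxE mulr_algl linearZ/=; congr (_ * _).
  rewrite mxE linear_sum/=; under eq_bigr do rewrite key.
  rewrite exchange_big/=; apply: eq_bigr => l _.
  rewrite -mulr_suml; congr (_ * _).
  rewrite /wishart_moment /tr_state WE mulr_sumr; apply: eq_bigr => j _.
  rewrite (bigD1 j)//= big1 ?addr0; last first.
    by move=> k kj; rewrite (negPf kj) mul0r mulr0.
  by rewrite eqxx mul1r mulrC.
under [LHS]eq_bigr do rewrite mulr_sumr.
rewrite exchange_big/=; apply: eq_bigr => l _.
rewrite !mxE mulr_sumr; apply: eq_bigr => h _.
by rewrite !mxE mulrCA.
Qed.

End WishartRecursion.

(** * The moment problem for compactly supported laws *)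

Section MomentProblem.
Variable R : realType.

(* Newton's iteration for [y^-2 = 1] has polynomial iterates, which converge
   pointwise to the sign of [y] on [[-1, 1]]. *)
Definition sign_step (y : R) : R := y * (3 - y ^+ 2) / 2.
Definition sign_seq (y : R) (n : nat) : R := iter n sign_step y.

Lemma sign_seqN y n : sign_seq (- y) n = - sign_seq y n.
Proof.
rewrite /sign_seq; elim: n => //= n ->; rewrite /sign_step sqrrN; ring.
Qed.

(** One step multiplies the error [1 - g] by [1 - (g + g ^+ 2) / 2], which is at most [1 - y / 2] as
    long as [y <= g]; the iterates never fall below [y]. *)
Lemma sign_seq_bound y n : 0 <= y <= 1 ->
  y <= sign_seq y n <= 1 /\ 1 - sign_seq y n <= (1 - y / 2) ^+ n.
Proof.
move=> /andP[y0 y1]; elim: n => [|n [/andP[yg g1] IH]].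
  by rewrite /sign_seq/= lexx y1 expr0; split => //; lra.
rewrite /sign_seq/= -/(sign_seq y n); set g := sign_seq y n in yg g1 IH *.
have gE : 1 - sign_step g = (1 - g) * (1 - (g + g ^+ 2) / 2).
  by rewrite /sign_step; field.
split.
  have : 0 <= (1 - g) * (1 - (g + g ^+ 2) / 2) by apply: mulr_ge0; nra.
  rewrite -gE subr_ge0 => ->; rewrite andbT (le_trans yg)// /sign_step; nra.
rewrite gE [leRHS]exprSr; apply: ler_pM => //; nra.
Qed.

Lemma cvg_sign_seq y : -1 <= y <= 1 -> sign_seq y @ \oo --> Num.sg y.
Proof.
have pos z : 0 < z <= 1 -> sign_seq z @ \oo --> (1 : R).
  move=> /andP[z0 z1].
  have b n := @sign_seq_bound z n (introT andP (conj (ltW z0) z1)).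
  apply: (@squeeze_cvgr _ _ _ _ (fun n => 1 - (1 - z / 2) ^+ n) (cst 1)).
  - by apply: nearW => n; have [/andP[_ ->] h] := b n; rewrite andbT /cst; lra.
  - rewrite -[X in _ --> X]subr0; apply: cvgB; first exact: cvg_cst.
    by apply: cvg_expr; rewrite ger0_norm; lra.
  - exact: cvg_cst.
move=> /andP[yN1 y1]; case: sgrP => [->|y0|y0].
- have -> : sign_seq 0 = cst 0.
    apply/funext => n; rewrite /sign_seq; elim: n => //= n ->.
    by rewrite /cst /sign_step !mul0r.
  exact: cvg_cst.
- by apply: pos; rewrite y0.
- have -> : sign_seq y = - sign_seq (- y).
    by apply/funext => n; rewrite -{1}[y]opprK sign_seqN.
  by apply: cvgN; apply: pos; rewrite oppr_gt0 y0/=; lra.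
Qed.

Lemma sign_seq_norm y n : -1 <= y <= 1 -> `|sign_seq y n| <= 1.
Proof.
move=> /andP[yN1 y1]; have [y0|y0] := leP 0 y.
  have [/andP[h h1] _] := @sign_seq_bound y n (introT andP (conj y0 y1)).
  by rewrite ler_norml h1 andbT (le_trans _ h)//; lra.
rewrite -[y]opprK sign_seqN normrN.
have /(sign_seq_bound n)[/andP[h h1] _] : 0 <= - y <= 1 by apply/andP; split; lra.
by rewrite ler_norml h1 andbT (le_trans _ h)//; lra.
Qed.

Fixpoint sign_poly (G : {poly R}) (n : nat) : {poly R} :=
  if n is m.+1 then 2^-1 *: (sign_poly G m * (3%:P - sign_poly G m ^+ 2)) else G.

Lemma horner_sign_poly G n x : (sign_poly G n).[x] = sign_seq G.[x] n.
Proof.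
elim: n => //= n IH.
by rewrite hornerZ hornerM hornerD hornerN horner_exp hornerC IH /sign_step; ring.
Qed.

Section OneMeasure.
Variables (mu : {measure set (measurableTypeR R) -> \bar R}) (B : R).
Hypothesis mu1 : mu [set: R] = 1%E.
Hypothesis muB : mu (~` `[- B, B]) = 0%E.

Let I : set (measurableTypeR R) := `[- B, B]%classic.

Let mI : measurable I. Proof. exact: measurable_itv. Qed.

Let mux_lty (E : set (measurableTypeR R)) : measurable E -> (mu E < +oo)%E.
Proof.
move=> mE; rewrite (le_lt_trans (_ : mu E <= mu setT)%E)//; last by rewrite mu1 ltry.
by rewrite le_measure ?inE.
Qed.

Lemma measure_supportE (E : set (measurableTypeR R)) : measurable E -> mu (E `&` I) = mu E.
Proof.
move=> mE; have mEC : measurable (E `&` ~` I) by apply: measurableI => //; exact: measurableC.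
rewrite -[in RHS](setIT E) -(setUv I) setIUr measureU//.
- rewrite [X in (_ + X)%E](subset_measure0 _ _ (@subIsetr _ E (~` I)))// ?adde0//.
  exact: measurableC.
- exact: measurableI.
- by rewrite setIACA setICr setI0.
Qed.

Lemma poly_integrable_support (P : {poly R}) : mu.-integrable I (EFin \o horner P).
Proof.
apply: measurable_bounded_integrable => //; first exact: mux_lty.
  by apply: measurable_funTS; apply: continuous_measurable_fun; exact: continuous_horner.
have cP : {within I, continuous (horner P)}.
  by apply: continuous_subspaceT; exact: continuous_horner.
have /compact_bounded[M [_ mrt]] := continuous_compact cP (@segment_compact _ _ _).
by exists M; split; rewrite ?num_real // => ? ? ? ?; exact: mrt.
Qed.

Lemma Rintegral_support k :
  \int[mu]_x (x ^+ k) = \int[mu]_(x in I) ('X^k).[x].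
Proof.
have mIC : measurable (~` I) by exact: measurableC.
have mX : measurable_fun [set: measurableTypeR R] (fun x : R => (x ^+ k)%:E).
  by apply/measurable_EFinP; exact: exprn_measurable.
have IE : [set: measurableTypeR R] `\` ~` I = I by rewrite setTD setCK.
rewrite /Rintegral (negligible_integral (N := ~` I))//.
  by rewrite IE; congr fine; apply: eq_integral => x _; rewrite hornerXn.
apply/integrableP; split => //.
rewrite (ge0_negligible_integral (N := ~` I))//.
  rewrite IE; have /integrableP[_] := poly_integrable_support 'X^k.
  have -> : EFin \o horner 'X^k = (fun x : R => (x ^+ k)%:E).
    by apply: funext => x; rewrite /= hornerXn.
  by [].
exact: measurableT_comp.
Qed.

Lemma Rintegral_poly_linear : scalar (fun P : {poly R} => \int[mu]_(x in I) P.[x]).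
Proof.
move=> a P Q; under eq_Rintegral do rewrite hornerD hornerZ.
rewrite RintegralD ?RintegralZl//; try exact: poly_integrable_support.
have -> : EFin \o (fun x => a * P.[x]) = EFin \o (horner (a *: P)).
  by apply/funext => x /=; rewrite hornerZ.
exact: poly_integrable_support.
Qed.

(* The indicator of the positive reals is [(sgn^2 + sgn) / 2]. *)
Lemma ray_approx (t : R) : let g := sign_poly ((B + `|t| + 1)^-1 *: ('X - t%:P)) in
  (\int[mu]_(x in I) (2^-1 *: (g n ^+ 2 + g n)).[x])%:E @[n --> \oo] --> mu `]t, +oo[%classic.
Proof.
move=> g; set S := fun n => 2^-1 *: (g n ^+ 2 + g n).
(* On the support the distance from [x] to [t] is at most the sum of [B] and the modulus of [t], so
   [y x] lies in [[-1, 1]] with the sign of [x - t]; the summand 1 keeps the divisor positive. *)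
pose y x := (B + `|t| + 1)^-1 * (x - t).
have c0 x : I x -> 0 < B + `|t| + 1.
  by rewrite /I/= in_itv/= => /andP[xB Bx]; have := normr_ge0 t; lra.
have y1 x : I x -> -1 <= y x <= 1.
  move=> /[dup] /c0 {}c0; rewrite /I/= in_itv/= => /andP[xB Bx].
  have := ler_norm t; have := ler_norm (- t); rewrite normrN => tt1 tt2.
  by rewrite /y mulrC ler_pdivlMr// ler_pdivrMr//; apply/andP; split; lra.
have SE n x : (S n).[x] = (sign_seq (y x) n ^+ 2 + sign_seq (y x) n) / 2.
  rewrite /S /g hornerZ hornerD horner_exp horner_sign_poly hornerZ hornerXsubC mulrC //.
have rayE : mu `]t, +oo[%classic = (\int[mu]_(x in I) (\1_(`]t, +oo[%classic : set R) x)%:E)%E.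
  by rewrite integral_indic// measure_supportE.
rewrite rayE.
have -> : (fun n => (\int[mu]_(x in I) (S n).[x])%:E) = (fun n => \int[mu]_(x in I) ((S n).[x])%:E)%E.
  apply/funext => n; rewrite /Rintegral fineK//; apply: integrable_fin_num => //.
  exact: poly_integrable_support.
have [] := @dominated_convergence _ _ _ mu I mI (fun n x => ((S n).[x])%:E)
  (fun x => (\1_(`]t, +oo[%classic : set R) x)%:E) (cst 1%E) _ _ _ _ _ => //.
- move=> n; apply/measurable_EFinP; apply: measurable_funTS.
  by apply: continuous_measurable_fun; exact: continuous_horner.
- by apply/measurable_EFinP; apply: measurable_funTS; exact: measurable_indic.
- apply: aeW => x Ix; apply: cvg_EFin; first exact: nearW.
  rewrite [X in X @ _](_ : _ = (fun n => (sign_seq (y x) n ^+ 2 + sign_seq (y x) n) / 2)); last first.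
    by apply/funext => n; rewrite /= SE.
  (* The sign 0 at [x = t] gives the value 0, so the limit is exactly the open ray, even if [t] is
     an atom. *)
  have -> : \1_(`]t, +oo[%classic : set R) x = (Num.sg (y x) ^+ 2 + Num.sg (y x)) / 2.
    rewrite indicE mem_setE in_itv/= andbT /y sgrM gtr0_sg ?mul1r; last first.
      by rewrite invr_gt0 (c0 x).
    by rewrite -subr_gt0; case: sgrP => _ /=; field.
  apply: cvgMl; apply: cvgD; last exact: cvg_sign_seq (y1 _ Ix).
  by under eq_fun do rewrite expr2; rewrite expr2; apply: cvgM; exact: cvg_sign_seq (y1 _ Ix).
- apply/integrableP; split => //.
  rewrite (eq_integral (cst 1%E)) => [|x _]; last by rewrite /= normr1.
  by rewrite integral_cst// mul1e; exact: mux_lty.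
- apply: aeW => x n Ix; rewrite /cst lee_fin SE.
  have := @sign_seq_norm (y x) n (y1 _ Ix); rewrite !ler_norml => /andP[h1 h2].
  by apply/andP; split; nra.
Qed.
End OneMeasure.

Lemma compact_support_itv (K K' : set R) : compact K -> compact K' ->
  exists B : R, K `|` K' `<=` `[- B, B].
Proof.
move=> cK cK'; have /compact_bounded[M [_ MK]] := compactU cK cK'.
exists (`|M| + 1) => x Kx; rewrite /= in_itv/= -ler_norml.
by apply: MK Kx; rewrite ltr_pwDr// ler_norm.
Qed.

(** Equal moments give equal integrals of polynomials over a common interval, hence equal masses of
    open rays; these are stable under intersection and generate the Borel sets. *)
Lemma compact_moments_unique (mu nu : {measure set (measurableTypeR R) -> \bar R})
    (K K' : set R) :
  mu [set: R] = 1%E -> nu [set: R] = 1%E -> compact K -> compact K' ->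
  mu (~` K) = 0%E -> nu (~` K') = 0%E ->
  (forall k, \int[mu]_x (x ^+ k) = \int[nu]_x (x ^+ k)) -> same_measure mu nu.
Proof.
move=> mu1 nu1 cK cK' muK nuK mom; have [B KB] := compact_support_itv cK cK'.
have null (m : {measure set (measurableTypeR R) -> \bar R}) (L : set R) :
    compact L -> L `<=` `[- B, B] -> m (~` L) = 0%E -> m (~` `[- B, B]) = 0%E.
  move=> cL LB; apply: subset_measure0.
  - by apply: measurableC; exact: measurable_itv.
  - by apply: measurableC; exact: compact_measurable.
  - exact: subsetC.
have muB := null _ _ cK (subset_trans (@subsetUl _ _ _) KB) muK.
have nuB := null _ _ cK' (subset_trans (@subsetUr _ _ _) KB) nuK.
have poly_eq : forall P : {poly R}, \int[mu]_(x in `[- B, B]) P.[x] = \int[nu]_(x in `[- B, B]) P.[x].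
  apply: poly_scalar_ext.
  - exact: Rintegral_poly_linear.
  - exact: Rintegral_poly_linear.
  - by move=> k; rewrite -!Rintegral_support.
have ray_eq t : mu `]t, +oo[%classic = nu `]t, +oo[%classic.
  have /= h1 := ray_approx mu1 muB (t := t); have /= h2 := ray_approx nu1 nuB (t := t).
  move: h1; under eq_fun do rewrite poly_eq.
  by move=> h1; rewrite -(cvg_lim (@ereal_hausdorff R) h1) (cvg_lim (@ereal_hausdorff R) h2).
move=> E mE; apply: (@measure_unique _ _ (measurableTypeR R) (@RGenOInfty.G R)
  (fun n => `](- n%:R), +oo[%classic) _ _ _ _ mu nu _ _ E mE).
- exact: RGenOInfty.measurableE.
- move=> _ _ [x ->] [y ->]; exists (Num.max x y).
  by apply/seteqP; split => z /=; rewrite !in_itv/= !andbT gt_max => /andP.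
- by move=> n; exists (- n%:R).
- apply/seteqP; split=> // x _; exists (Num.trunc `|x|).+1 => //=.
  rewrite in_itv/= andbT ltrNl.
  by rewrite (le_lt_trans _ (truncnS_gt _))// -normrN ler_norm.
- by move=> _ [x ->]; exact: ray_eq.
- move=> n; rewrite (le_lt_trans (_ : _ <= mu setT)%E)//; last by rewrite mu1 ltry.
  by rewrite le_measure ?inE.
Qed.
End MomentProblem.

(** * Power sums and spectral measures *)

Section MomentPowerSums.
Variables (K : fieldType) (c : K).
Hypothesis c0 : c != 0.

(** The scalar shadow of the matrix recursion: [t j k] stands for the trace of [D^j N_k D] and [q j]
    for that of [D^(j+1)]. Unfolding [N_(k+1)] puts one more [D] on the left, which raises [j]. *)
Definition trace_rec (m : nat -> K) (t : nat -> nat -> K) (q : nat -> K) : Prop :=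
  [/\ m 0 = 1, forall n, m n.+1 = c * \sum_(k < n.+1) t 0 k * m (n - k)%N,
      forall j, t j 0 = q j
    & forall j k, t j k.+1 = \sum_(l < k.+1) m l * t j.+1 (k - l)%N].

Lemma trace_rec_moments m t q m' t' q' :
  trace_rec m t q -> trace_rec m' t' q' -> q =1 q' -> m =1 m'.
Proof.
move=> [m0 mS t0 tS] [m0' mS' t0' tS'] qq' n.
suff /(_ n)[h _] : forall n, (forall k, (k <= n)%N -> m k = m' k) /\
    (forall j k, (k <= n)%N -> t j k = t' j k) by exact: h.
elim=> [|{}n [IHm IHt]].
  by split=> [|j] k; rewrite leqn0 => /eqP->; rewrite ?m0 ?m0' ?t0 ?t0'.
split=> [|j] k; rewrite leq_eqVlt ltnS => /predU1P[->|]; [|exact: IHm| |exact: IHt].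
  rewrite mS mS'; congr (_ * _); apply: eq_bigr => i _.
  by rewrite IHt ?IHm ?leq_subr// -ltnS.
rewrite tS tS'; apply: eq_bigr => l _.
by rewrite IHm ?IHt ?leq_subr// -ltnS.
Qed.

(** Triangularity with respect to the weight [j + k]: [t j k] involves [q] up to index [j + k], and
    [q (j + k)] enters only through the terms [l = 0], with coefficient [m 0 = 1]. Along an
    antidiagonal the difference of the two systems is thus constant, and it is zero at [j = 0],
    where [t 0] is recovered from [m] by dividing by [c]. *)
Lemma trace_rec_power_sums m t q m' t' q' :
  trace_rec m t q -> trace_rec m' t' q' -> m =1 m' -> q =1 q'.
Proof.
move=> [m0 mS t0 tS] [m0' mS' t0' tS'] mm'.
have tt n : t 0 n = t' 0 n.
  elim/ltn_ind: n => n IH; have := mm' n.+1; rewrite mS mS' => /(mulfI c0).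
  rewrite !big_ord_recr/= subnn m0 m0' !mulr1.
  rewrite (eq_bigr (fun k : 'I_n => t' 0 k * m' (n - k)%N)) => [/addrI //|k _].
  by rewrite IH ?mm'.
move=> n; elim/ltn_ind: n => n IH.
have low k j : (j + k < n)%N -> t j k = t' j k.
  elim/ltn_ind: k j => -[|k] IHk j jk; first by rewrite t0 t0' IH// -[j]addn0.
  rewrite tS tS'; apply: eq_bigr => l _; rewrite mm' IHk//; first by lia.
  by have := ltn_ord l; lia.
have top k j : (j + k = n)%N -> t j k - t' j k = q n - q' n.
  elim: k j => [|k IHk] j jk; first by rewrite t0 t0' -jk addn0.
  rewrite tS tS' !big_ord_recl/= !subn0 m0 m0' !mul1r -(IHk j.+1); last by lia.
  rewrite (eq_bigr (fun l : 'I_k => m' (bump 0 l) * t' j.+1 (k - bump 0 l)%N)); last first.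
    by move=> l _; rewrite mm' low// /bump/=; have := ltn_ord l; lia.
  by rewrite opprD addrACA subrr addr0.
by have := top n 0 (add0n n); rewrite tt subrr => /esym/eqP; rewrite subr_eq0 => /eqP.
Qed.

End MomentPowerSums.

Section Eigenvalues.
Variables (R : realType) (p : nat).
Implicit Types (D : 'M[R[i]]_p).

Definition eigenvalues D : seq R := [seq real_eigenvalue D k | k : 'I_p].

Lemma tr_power D n : D \is hermsymmx ->
  \tr (D ^+ n) = (\sum_(x <- eigenvalues D) x ^+ n)%:C.
Proof.
move=> hD; set U := spectralmx D; set s := spectral_diag D.
have Uu : U \in unitmx by exact: spectral_unit.
have /orthomx_spectralP DE := hermitian_normalmx hD.
rewrite -/U -/s in DE.
have DnE : D ^+ n = invmx U *m diag_mx (\row_k (s 0 k) ^+ n) *m U.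
  elim: n => [|n IH].
    have -> : \row_k (s 0 k) ^+ 0 = const_mx 1 by apply/rowP => k; rewrite !mxE expr0.
    by rewrite diag_const_mx mulmx1 (mulVmx Uu).
  rewrite exprS -mulmxE IH {1}DE !mulmxA (mulmxK Uu).
  have -> : \row_k (s 0 k) ^+ n.+1 = \row_j (s 0 j * (\row_k (s 0 k) ^+ n) 0 j).
    by apply/rowP => k; rewrite !mxE exprS.
  by rewrite -mulmx_diag !mulmxA.
rewrite DnE mxtrace_mulC mulmxA (mulmxV Uu) mul1mx mxtrace_diag.
rewrite /eigenvalues big_map big_enum rmorph_sum/=; apply: eq_bigr => k _.
rewrite mxE rmorphXn/=; congr (_ ^+ n).
by have /mxOverP/(_ 0 k) := hermitian_spectral_diag_real hD; rewrite -/s => /RRe_real.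
Qed.

(** Equal power sums give equal sums of any polynomial. The product [Q] over all listed values other
    than [x] isolates the multiplicity of [x], which is then read off in characteristic zero. *)
Lemma perm_power_sums (e e' : seq R) :
  (forall n, \sum_(x <- e) x ^+ n = \sum_(x <- e') x ^+ n) -> perm_eq e e'.
Proof.
move=> h.
have hP : forall P : {poly R}, \sum_(x <- e) P.[x] = \sum_(x <- e') P.[x].
  apply: poly_scalar_ext.
  - move=> a P Q; rewrite mulr_sumr -big_split/=.
    by apply: eq_bigr => x _; rewrite hornerD hornerZ.
  - move=> a P Q; rewrite mulr_sumr -big_split/=.
    by apply: eq_bigr => x _; rewrite hornerD hornerZ.
  - move=> n; under eq_bigr do rewrite hornerXn; rewrite h.
    by apply: eq_bigr => x _; rewrite hornerXn.
apply/allP => x _ /=; set r := [seq y <- e ++ e' | y != x].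
pose Q := \prod_(y <- r) ('X - y%:P).
have Qx : Q.[x] != 0.
  by rewrite -/(root Q x) root_prod_XsubC mem_filter eqxx.
have QE (l : seq R) : {subset l <= e ++ e'} ->
    \sum_(y <- l) Q.[y] = (count_mem x l)%:R * Q.[x].
  elim: l => [|y l IH] yl /=; first by rewrite big_nil mul0r.
  rewrite big_cons IH; last by move=> z zl; apply: yl; rewrite inE zl orbT.
  rewrite natrD mulrDl; congr (_ + _).
  have [->|yx] := eqVneq y x; first by rewrite mul1r.
  rewrite mul0r; apply/eqP; rewrite -/(root Q y) root_prod_XsubC mem_filter yx.
  by rewrite yl// mem_head.
have := hP Q; rewrite !QE => [/(mulIf Qx)/eqP||]; last 2 first.
- by move=> y ye; rewrite mem_cat ye orbT.
- by move=> y ye; rewrite mem_cat ye.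
by rewrite eqr_nat.
Qed.

Lemma spectral_measure_eigenvalues D (E : set (measurableTypeR R)) :
  spectral_measure D E = ((p%:R^-1 : R)%:E * \sum_(x <- eigenvalues D) \d_x E)%E.
Proof. by rewrite /spectral_measure /eigenvalues big_map big_enum. Qed.

(** The mass of a point is its multiplicity divided by [p], so singletons already recover the
    multiset. *)
Lemma same_spectral_measureP D D' : (0 < p)%N ->
  same_measure (spectral_measure D) (spectral_measure D') <->
  perm_eq (eigenvalues D) (eigenvalues D').
Proof.
move=> p0; split=> [h|h E _]; last first.
  by rewrite !spectral_measure_eigenvalues (perm_big _ h).
apply/allP => x _ /=; have := h [set x] (measurable_set1 x).
have dirac_count (l : seq R) :
    (\sum_(y <- l) \d_y [set x : measurableTypeR R] = (count_mem x l)%:R%:E)%E.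
  elim: l => [|y l IH]; first by rewrite big_nil.
  rewrite big_cons IH /= natrD EFinD diracE; congr (_%:R%:E + _)%E.
  by congr nat_of_bool; apply/idP/eqP => [/set_mem//|->]; exact/mem_set.
rewrite !spectral_measure_eigenvalues !dirac_count => -[].
have pV : p%:R^-1 != 0 :> R by rewrite invr_eq0 pnatr_eq0 -lt0n.
by move=> /(mulfI pV)/eqP; rewrite eqr_nat.
Qed.

End Eigenvalues.

(** * The equivalence of the two laws *)

Lemma wishart_trace_rec (R : realType) (A : cstarAlgType R) (tau : {scalar A})
    (p d : nat) (C : 'M[A]_(p, d)) (D : 'M[R[i]]_p) :
  faithful_tracial_state tau -> (0 < d)%N ->
  star_free_circular tau (fun ij : 'I_p * 'I_d => C ij.1 ij.2) ->
  (forall i j, tau (star (C i j) * C i j) = d%:R^-1) ->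
  trace_rec d%:R^-1 (wishart_moment tau C D)
    (fun j k => \tr (D ^+ j *m dual_moment tau C D k *m D))
    (fun j => \tr (D ^+ j.+1)).
Proof.
move=> [tau1 _ _ tauC] d0 hC hvar; split.
- rewrite /wishart_moment /tr_state expr0.
  under eq_bigr do rewrite mxE eqxx tau1.
  by rewrite sumr_const card_ord mulVf// pnatr_eq0 -lt0n.
- move=> n; rewrite (wishart_moment_rec tau1 tauC hC hvar); congr (_ * _); apply: eq_bigr => k _.
  by rewrite expr0 mul1mx.
- by move=> j; rewrite (dual_moment0 tau1) mulmx1 exprSr.
- move=> j k; rewrite (dual_moment_rec tau1 tauC hC hvar) mulmx_sumr mulmx_suml linear_sum/=.
  apply: eq_bigr => l _; rewrite -scalemxAr -scalemxAl linearZ/= exprSr -mulmxE.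
  by rewrite !mulmxA.
Qed.

Theorem mainTheorem2 (R : realType) (A : cstarAlgType R) (tau : {scalar A})
    (htau : faithful_tracial_state tau) (p d : nat)
    (hp : (0 < p)%N) (hd : (0 < d)%N) (C : 'M[A]_(p, d))
    (hC : star_free_circular tau (fun ij : 'I_p * 'I_d => C ij.1 ij.2))
    (hC_mean : forall (i : 'I_p) (j : 'I_d), tau (C i j) = 0)
    (hC_var : forall (i : 'I_p) (j : 'I_d),
       tau (star (C i j) * C i j) = d%:R^-1)
    (D D' : 'M[R[i]]_p) (hD : D \is hermsymmx) (hD' : D' \is hermsymmx)
    (mu mu' : {measure set (measurableTypeR R) -> \bar R})
    (hmu : is_distribution (tr_state tau (d:=d)) (wishart C D) mu)
    (hmu' : is_distribution (tr_state tau (d:=d)) (wishart C D') mu') :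
  same_measure (spectral_measure D) (spectral_measure D') <->
  same_measure mu mu'.
Proof.
have rec := wishart_trace_rec D htau hd hC hC_var.
have rec' := wishart_trace_rec D' htau hd hC hC_var.
move: hmu hmu' => [mu1 [K cK muK] mom] [mu1' [K' cK' muK'] mom'].
split=> [/(same_spectral_measureP _ _ hp) ev|mumu'].
- apply: (compact_moments_unique mu1 mu1' cK cK' muK muK') => k.
  apply: complexI; rewrite mom mom'.
  apply: (trace_rec_moments rec rec') => j.
  by rewrite (tr_power _ hD) (tr_power _ hD') (perm_big _ ev).
- apply/(same_spectral_measureP _ _ hp)/perm_power_sums => n.
  have mm k : wishart_moment tau C D k = wishart_moment tau C D' k.
    rewrite /wishart_moment -mom -mom'; congr (fine _)%:C.
    by apply: eq_measure_integral => E mE _; exact: mumu'.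
  (* The recursion yields only the exponents [n.+1]; for exponent 0 both power sums count the [p]
     eigenvalues. *)
  case: n => [|n].
    by rewrite !big_map; apply: eq_bigr => k _; rewrite !expr0.
  have d0 : d%:R^-1 != 0 :> R[i] by rewrite invr_eq0 pnatr_eq0 -lt0n.
  apply: complexI; rewrite -(tr_power _ hD) -(tr_power _ hD').
  exact: (trace_rec_power_sums d0 rec rec' mm n).
Qed.
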